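(* Consider the numerical method $$\begin{pmatrix}x_{n+1}\\ y_{n+1}\end{pmatrix}=A\begin{pmatrix}x_n\\ y_n\end{pmatrix}+\alpha\, b\,\Delta W_n,\qquad A=\begin{pmatrix}a_{11}&a_{12}\\ a_{21}&a_{22}\end{pmatrix},\quad b=\begin{pmatrix}b_1\\ b_2\end{pmatrix},$$ with step-size $h>0$, approximating the linear stochastic oscillator (see context), and suppose (A1) $4\det(A)-(\mathrm{tr}(A))^2>0$; (A3) $0<\det(A)<1$; (A4) $b_1+a_{12}b_2-a_{22}b_1\neq0$. Then: (1) The method is non-symplectic, i.e. it does not satisfy $\mathrm dx_{n+1}\wedge\mathrm dy_{n+1}=\mathrm dx_n\wedge\mathrm dy_n$. (2) The discrete mean position $A_N=\frac1N\sum_{n=0}^{N-1}x_n$, $N\ge1$, satisfies a large deviations principle (as $N\to\infty$, with speed $N$) with the good rate function $$\widetilde I^h(y)=\frac{y^2}{2\alpha^2h}\left(\frac{1-\mathrm{tr}(A)+\det(A)}{b_1+a_{12}b_2-a_{22}b_1}\right)^2.$$ (3) Moreover, if (A1), (A3) and (A4) hold for all sufficiently small $h$ and, in addition, as $h\to0$, (B) $|a_{11}-1|+|a_{22}-1|+|a_{12}-h|+|a_{21}+h|=\mathcal O(h^2)$ and $|b_1|+|b_2-1|=\mathcal O(h)$, then the method does not asymptotically preserve the large deviations principle of the mean position $\{A_T\}_{T>0}$ of the exact solution, i.e. for every $y\ne0$, $$\lim_{h\to0}\widetilde I^h_{mod}(y)\neq I(y),$$ where $\widetilde I^h_{mod}(y)=\widetilde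 I^h(y)/h$ and $I(y)=\frac{y^2}{3\alpha^2}$ is the rate function of the large deviations principle of $\{A_T\}_{T>0}$.
   Context: Let $\alpha>0$, $x_0,y_0\in\mathbb R$ and let $W$ be a one-dimensional standard Brownian motion on a complete filtered probability space. The linear stochastic oscillator is $\mathrm dX_t=Y_t\,\mathrm dt$, $\mathrm dY_t=-X_t\,\mathrm dt+\alpha\,\mathrm dW_t$, $(X_0,Y_0)=(x_0,y_0)$, and $A_T=\frac1T\int_0^TX_t\,\mathrm dt$; $\{A_T\}_{T>0}$ satisfies a large deviations principle as $T\to\infty$ (speed $T$) with good rate function $I(y)=y^2/(3\alpha^2)$. Numerical method: for a step-size $h>0$, $t_n=nh$, $\Delta W_n=W_{t_{n+1}}-W_{t_n}$, started at $(x_0,y_0)$. The real matrix $A=A(h)$ and real vector $b=b(h)$ depend on the method and on the constant step-size $h$ (dependence suppressed in the notation), and throughout $b_1^2+b_2^2\ne0$. A family of real random variables $\{Z_N\}_{N\ge1}$ satisfies a large deviations principle with rate function $I$ (a lower semicontinuous function $\mathbb R\to[0,\infty]$; good if its level sets $\{I\le a\}$, $a\in[0,\infty)$, are compact) if $\liminf_{N\to\infty}\frac1N\log\mathbf P(Z_N\in U)\ge-\inf_UI$ for every open $U\subset\mathbb R$ and $\limsup_{N\to\infty}\frac1N\log\mathbf P(Z_N\in C)\le-\inf_CI$ for every closed $C\subset\mathbb R$. $R=\mathcal O(h^p)$ means $|R|\le Ch^p$ for all sufficiently small $h$, with $C$ independent of $h$. *)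

(* Defs.v *)
From HB Require Import structures.
From mathcomp Require Import all_boot all_order all_algebra.
From mathcomp Require Import all_classical all_reals all_analysis.

Set Implicit Arguments.
Unset Strict Implicit.
Unset Printing Implicit Defensive.
Import Order.TTheory GRing.Theory Num.Theory.
Import numFieldNormedType.Exports.
Local Open Scope classical_set_scope.
Local Open Scope ring_scope.

Section large_deviations.
Context {R : realType} {d : measure_display} {T : measurableType d}.

Definition rate_function (I : R -> \bar R) : Prop :=
  lower_semicontinuous I /\ forall y, (0 <= I y)%E.

Definition good_rate_function (I : R -> \bar R) : Prop :=
  rate_function I /\
  forall a : R, 0 <= a -> compact [set y | (I y <= a%:E)%E].

(* The family is indexed by N >= 1.  The value at N = 0 of the two sequences
   below is irrelevant to their limits.  [lne] is the extended logarithm, with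
   [lne 0 = -oo], and [ereal_inf set0 = +oo]. *)
Definition LDP (P : probability T R) (Z : nat -> T -> R) (I : R -> \bar R)
    : Prop :=
  [/\ rate_function I,
      forall N, (0 < N)%N -> measurable_fun setT (Z N),
      forall U : set R, open U ->
        (- ereal_inf (I @` U) <=
         limn_einf (fun N => N%:R^-1%:E * lne (P (Z N @^-1` U))))%E &
      forall C : set R, closed C ->
        (limn_esup (fun N => N%:R^-1%:E * lne (P (Z N @^-1` C))) <=
         - ereal_inf (I @` C))%E].

End large_deviations.

Section brownian_motion.
Context {R : realType} {d : measure_display} {T : measurableType d}.

(* Time is [0, +oo[: only the values at t >= 0 of a filtration [F] or of a
   process [W] matter. *)
Definition filtration (F : R -> set_system T) : Prop :=
  (forall t, 0 <= t -> sigma_algebra setT (F t) /\ F t `<=` measurable) /\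
  (forall s t, 0 <= s -> s <= t -> F s `<=` F t).

Definition complete_filtered_probability_space
    (P : probability T R) (F : R -> set_system T) : Prop :=
  [/\ measure_is_complete P, filtration F & P.-negligible `<=` F 0].

(* [normal_prob m s] is the normal law of mean [m] and standard deviation [s]. *)
Definition brownian_motion (P : probability T R) (F : R -> set_system T)
    (W : R -> T -> R) : Prop :=
  [/\ forall t, 0 <= t -> forall B : set R, measurable B -> F t (W t @^-1` B),
      {ae P, forall w, W 0 w = 0},
      {ae P, forall w, {within `[0, +oo[, continuous (W ^~ w)}},
      forall s t : R, 0 <= s -> s < t -> forall (E : set T) (B : set R),
        F s E -> measurable B ->
        let D := W t \- W s in
        P (E `&` D @^-1` B) = (P E * P (D @^-1` B))%E &
      forall s t : R, 0 <= s -> s < t -> forall B : set R, measurable B ->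
        P ((W t \- W s) @^-1` B) = normal_prob 0 (Num.sqrt (t - s)) B].

End brownian_motion.

Section numerical_method.
Context {R : realType}.

Definition vec2 (x y : R) : 'cV[R]_2 := \col_i (if i == 0 then x else y).

Definition increment (T : Type) (W : R -> T -> R) (h : R) (n : nat) (w : T)
    : R :=
  W (n.+1%:R * h) w - W (n%:R * h) w.

Section trajectory.
Context {T : Type}.
Variables (W : R -> T -> R) (alpha h : R) (A : 'M[R]_2) (b : 'cV[R]_2).

Fixpoint method (z0 : 'cV[R]_2) (n : nat) (w : T) : 'cV[R]_2 :=
  if n is n'.+1 then
    A *m method z0 n' w + (alpha * increment W h n' w) *: b
  else z0.

Definition position (z0 : 'cV[R]_2) (n : nat) (w : T) : R := method z0 n w 0 0.
Definition momentum (z0 : 'cV[R]_2) (n : nat) (w : T) : R := method z0 n w 1 0.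

Definition mean_position (z0 : 'cV[R]_2) (N : nat) (w : T) : R :=
  N%:R^-1 * \sum_(0 <= n < N) position z0 n w.

End trajectory.

(* The 2-form df /\ dg at the point z, applied to the tangent vectors u, v. *)
Definition wedge_d (f g : 'cV[R]_2 -> R) (z u v : 'cV[R]_2) : R :=
  'd f z u * 'd g z v - 'd f z v * 'd g z u.

(* dx_(n+1) /\ dy_(n+1) = dx_n /\ dy_n, almost surely for all n, the numerical
   solution being differentiated with respect to its initial value z0. *)
Definition symplectic_method (d : measure_display) (T : measurableType d)
    (P : probability T R) (W : R -> T -> R) (alpha h : R)
    (A : 'M[R]_2) (b : 'cV[R]_2) : Prop :=
  let x n w z := position W alpha h A b z n w in
  let y n w z := momentum W alpha h A b z n w in
  {ae P, forall w, forall (n : nat) (z0 u v : 'cV[R]_2),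
    wedge_d (x n.+1 w) (y n.+1 w) z0 u v = wedge_d (x n w) (y n w) z0 u v}.

Definition condA1 (A : 'M[R]_2) : Prop := 0 < 4 * \det A - (\tr A) ^+ 2.

Definition condA3 (A : 'M[R]_2) : Prop := 0 < \det A < 1.

Definition condA4 (A : 'M[R]_2) (b : 'cV[R]_2) : Prop :=
  b 0 0 + A 0 1 * b 1 0 - A 1 1 * b 0 0 != 0.

Definition bigO_pow (f : R -> R) (p : nat) : Prop :=
  exists C : R, \forall h \near 0^'+, `|f h| <= C * h ^+ p.

Definition condB (A : R -> 'M[R]_2) (b : R -> 'cV[R]_2) : Prop :=
  bigO_pow (fun h => `|A h 0 0 - 1| + `|A h 1 1 - 1| + `|A h 0 1 - h|
                     + `|A h 1 0 + h|) 2 /\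
  bigO_pow (fun h => `|b h 0 0| + `|b h 1 0 - 1|) 1.

Definition method_rate (alpha h : R) (A : 'M[R]_2) (b : 'cV[R]_2) (y : R) : R :=
  y ^+ 2 / (2 * alpha ^+ 2 * h) *
  ((1 - \tr A + \det A) / (b 0 0 + A 0 1 * b 1 0 - A 1 1 * b 0 0)) ^+ 2.

Definition modified_rate (alpha h : R) (A : 'M[R]_2) (b : 'cV[R]_2) (y : R)
    : R :=
  method_rate alpha h A b y / h.

(* The rate function of the mean position A_T = T^-1 * \int_0^T X_t dt of the
   exact solution of dX = Y dt, dY = - X dt + alpha dW, as T tends to +oo. *)
Definition exact_rate (alpha y : R) : R := y ^+ 2 / (3 * alpha ^+ 2).

End numerical_method.

(* Main.v *)
(* Summing the recursion z_(n+1) = A z_n + alpha b dW_n over n < N gives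
     (I - A) (z_0 + ... + z_(N-1)) = z_0 - z_N + alpha (W_(Nh) - W_0) b,
   where det (I - A) = 1 - tr A + det A > 0 by (A1).  Hence N A_N is
   c (W_(Nh) - W_0), with c = alpha (b_1 + a_12 b_2 - a_22 b_1) / det (I - A),
   plus a linear functional of z_0 - z_N.  In a suitable Euclidean norm A is a
   multiple of an isometry with factor sqrt (det A) < 1, so |z_N| is bounded
   affinely in the largest of the |dW_j|, j < N; a union bound over j then shows
   that |z_N| exceeds r N with probability exp (- const N ^ 2) at most.  The
   boundary term is therefore exponentially negligible, and A_N satisfies the
   large deviations principle of the centred Gaussian c (W_(Nh) - W_0) / N, of
   variance c ^ 2 h / N.
   The numerical flow is affine in z_0 with linear part A, so symplecticity would
   force det A = 1.  Under (B), det (I - A) ~ h ^ 2 and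
   b_1 + a_12 b_2 - a_22 b_1 ~ h, so the modified rate tends to
   y ^ 2 / (2 alpha ^ 2). *)
Require Import Defs.
From HB Require Import structures.
From mathcomp Require Import all_boot all_order all_algebra.
From mathcomp Require Import all_classical all_reals all_analysis.
From mathcomp Require Import measurable_realfun ring lra.
Import Order.TTheory GRing.Theory Num.Theory.
Import numFieldNormedType.Exports.
Local Open Scope classical_set_scope.
Local Open Scope ring_scope.

(** * Contracting planar recursions *)

Section planar_recursion.
Variables (R : realFieldType) (a b c d : R).
Local Notation D := (a * d - b * c).
Hypothesis complex_eigenvalues : 0 < 4 * D - (a + d) ^+ 2.
Hypothesis D01 : 0 < D < 1.

(* The form z |-> c det(z, A z), multiplied by det A under z |-> A z and, as
   the eigenvalues are not real, positive definite: this is the square of a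
   norm in which A is sqrt(det A) times an isometry. *)
Let q (x y : R) := (c * x + (d - a) / 2 * y) ^+ 2
                   + (4 * D - (a + d) ^+ 2) / 4 * y ^+ 2.

Let qA x y : q (a * x + b * y) (c * x + d * y) = D * q x y.
Proof. by rewrite /q; field. Qed.

Let q_ge0 x y : 0 <= q x y.
Proof.
by rewrite addr_ge0 ?sqr_ge0// mulr_ge0 ?sqr_ge0// divr_ge0//; exact: ltW.
Qed.

(** For [c = 0] the discriminant hypothesis would read [0 < - (a - d) ^+ 2]. *)
Let c_neq0 : c != 0.
Proof.
apply/eqP => c0; move: complex_eigenvalues; rewrite c0.
by have := sqr_ge0 (a - d); lra.
Qed.

(** In terms of [u = c * x + g * y], the form is [u ^+ 2 + E * y ^+ 2] and [x = u / c - g / c * y].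
    The constant comes from [(s - t) ^+ 2 <= 2 * s ^+ 2 + 2 * t ^+ 2]; the leftover cross terms are
    nonnegative. *)
Let q_coercive : exists2 K, 0 <= K & forall x y, x ^+ 2 + y ^+ 2 <= K * q x y.
Proof.
set E := (4 * D - (a + d) ^+ 2) / 4; have E0 : 0 < E by rewrite divr_gt0.
set g := (d - a) / 2.
exists (2 / c ^+ 2 + (2 * (g / c) ^+ 2 + 1) / E).
  rewrite addr_ge0//; first by rewrite divr_ge0 ?sqr_ge0.
  by rewrite divr_ge0 ?(ltW E0)// addr_ge0// mulr_ge0 ?sqr_ge0.
move=> x y; set u := c * x + g * y.
have -> : q x y = u ^+ 2 + E * y ^+ 2 by [].
have -> : x = u / c - g / c * y by rewrite /u; field.
have xle : (u / c - g / c * y) ^+ 2 <= 2 / c ^+ 2 * u ^+ 2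
                                      + 2 * (g / c) ^+ 2 * y ^+ 2.
  rewrite [2 / c ^+ 2 * _](_ : _ = 2 * (u / c) ^+ 2); last by field.
  by have := sqr_ge0 (u / c + g / c * y); nra.
apply: (le_trans (lerD xle (lexx _))).
have -> : (2 / c ^+ 2 + (2 * (g / c) ^+ 2 + 1) / E) * (u ^+ 2 + E * y ^+ 2)
  = 2 / c ^+ 2 * u ^+ 2 + 2 * (g / c) ^+ 2 * y ^+ 2 + y ^+ 2
    + (2 / c ^+ 2 * (E * y ^+ 2) + (2 * (g / c) ^+ 2 + 1) / E * u ^+ 2).
  by field; rewrite c_neq0 gt_eqF.
rewrite lerDl addr_ge0// mulr_ge0 ?sqr_ge0//.
- by rewrite divr_ge0 ?sqr_ge0.
- by rewrite mulr_ge0 ?sqr_ge0 ?(ltW E0).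
- by rewrite divr_ge0 ?(ltW E0)// addr_ge0// mulr_ge0 ?sqr_ge0.
Qed.

(** Young's inequality on each of the two squares of [q]. A small weight [e] keeps the factor of the
    first term close to 1, so that contraction survives. *)
Let qD e x y s t : 0 < e ->
  q (x + s) (y + t) <= (1 + e) * q x y + (1 + e^-1) * q s t.
Proof.
move=> e0.
have young u v : (u + v) ^+ 2 <= (1 + e) * u ^+ 2 + (1 + e^-1) * v ^+ 2.
  rewrite -subr_ge0.
  have -> : (1 + e) * u ^+ 2 + (1 + e^-1) * v ^+ 2 - (u + v) ^+ 2
            = e^-1 * (e * u - v) ^+ 2 by field; rewrite gt_eqF.
  by rewrite mulr_ge0 ?sqr_ge0// invr_ge0 ltW.
rewrite /q; set E := _ / 4.
have E0 : 0 <= E by rewrite divr_ge0 ?(ltW complex_eigenvalues).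
have := young (c * x + (d - a) / 2 * y) (c * s + (d - a) / 2 * t).
have := ler_wpM2l E0 (young y t).
rewrite (_ : c * (x + s) + (d - a) / 2 * (y + t) =
  c * x + (d - a) / 2 * y + (c * s + (d - a) / 2 * t)); last by ring.
move=> h1 h2; apply: (le_trans (lerD h2 h1)).
by rewrite le_eqVlt; apply/orP; left; apply/eqP; ring.
Qed.

(** [K] is fixed before the path, the horizon [N] and the bound [M], so the estimate applies to each
    outcome separately. *)
Lemma planar_recursion_bound (p r x0 y0 : R) :
  exists2 K, 0 < K & forall x y w : nat -> R,
    x 0 = x0 -> y 0 = y0 ->
    (forall n, x n.+1 = a * x n + b * y n + p * w n) ->
    (forall n, y n.+1 = c * x n + d * y n + r * w n) ->
    forall N M, (forall j, (j < N)%N -> w j ^+ 2 <= M) -> 0 <= M ->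
      x N ^+ 2 + y N ^+ 2 <= K * (1 + M).
Proof.
have [K K0 Kq] := q_coercive; have /andP[D0 D1] := D01.
(* This [e] makes [(1 + e) * D] equal to [rho], the midpoint of [D] and 1. *)
set e := (1 - D) / (2 * D); set rho := (1 + D) / 2.
have e0 : 0 < e by rewrite divr_gt0 ?subr_gt0 ?mulr_gt0.
have eD : (1 + e) * D = rho by rewrite /e /rho; field; rewrite gt_eqF.
have rho1 : 0 < 1 - rho by rewrite /rho; lra.
have rho0 : 0 < rho by rewrite /rho; lra.
(* [B * M] is the fixed point of [v |-> rho * v + (1 + e^-1) * q p r * M], which lets the bound
   [q x0 y0 + B * M] pass through the induction. *)
set B := (1 + e^-1) * q p r / (1 - rho).
have B0 : 0 <= B.
  by rewrite divr_ge0 ?(ltW rho1)// mulr_ge0// addr_ge0// invr_ge0 ltW.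
exists (K * (q x0 y0 + B) + 1).
  by rewrite ltr_wpDl// mulr_ge0// addr_ge0.
move=> x y w x00 y00 xS yS N M wM M0.
have {wM} qN : q (x N) (y N) <= q x0 y0 + B * M.
  elim: N wM => [|N IH] wM; first by rewrite x00 y00 lerDl mulr_ge0.
  rewrite xS yS; apply: (le_trans (qD e _ _ _ _ e0)).
  rewrite qA mulrA eD.
  have -> : q (p * w N) (r * w N) = q p r * w N ^+ 2 by rewrite /q; ring.
  have IHN := ler_wpM2l (ltW rho0) (IH (fun j jN => wM j (ltnW jN))).
  have wNM : (1 + e^-1) * (q p r * w N ^+ 2) <= (1 - rho) * (B * M).
    rewrite (_ : (1 - rho) * (B * M) = (1 + e^-1) * q p r * M); last first.
      by rewrite /B; field; rewrite gt_eqF ?rho1//= gt_eqF.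
    rewrite mulrA; apply: ler_wpM2l (wM _ _) => //.
    by rewrite mulr_ge0// addr_ge0// invr_ge0 ltW.
  apply: (le_trans (lerD IHN wNM)).
  by have := q_ge0 x0 y0; nra.
apply: (le_trans (Kq _ _)); apply: (le_trans (ler_wpM2l K0 qN)).
have := q_ge0 x0 y0; have := mulr_ge0 K0 (q_ge0 x0 y0).
by have := mulr_ge0 K0 B0; nra.
Qed.

End planar_recursion.

(** First row of the adjugate of I - A applied to the telescoped recursion: this eliminates the sum
    of the [y n] without any division. *)
Lemma planar_recursion_sum (R : comPzRingType) (a b c d p r : R)
    (x y w : nat -> R) :
  (forall n, x n.+1 = a * x n + b * y n + p * w n) ->
  (forall n, y n.+1 = c * x n + d * y n + r * w n) ->
  forall N, ((1 - a) * (1 - d) - b * c) * \sum_(0 <= n < N) x n =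
    (1 - d) * (x 0 - x N) + b * (y 0 - y N)
    + ((1 - d) * p + b * r) * \sum_(0 <= n < N) w n.
Proof.
move=> xS yS; elim=> [|N IH]; first by rewrite !big_geq// !subrr !mulr0 !addr0.
by rewrite !big_nat_recr//= [LHS]mulrDr IH xS yS; ring.
Qed.

(** * Gaussian bounds *)

Lemma measurable_norm_ge {R : realType} {d : measure_display}
    {T : measurableType d} (f : T -> R) (r : R) :
  measurable_fun setT f -> measurable [set w | r <= `|f w|].
Proof.
move=> mf; rewrite -[X in measurable X]setTI.
apply: (@measurable_fun_le _ _ _ setT (cst r) (fun w => `|f w|)) => //.
exact: measurableT_comp.
Qed.

Section normal_bounds.
Context {R : realType}.
Implicit Types a s r y : R.

(* For [e x >= a >= 0] one has [x ^ 2 >= a ^ 2 + (x - e a) ^ 2], so on the half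
   line the density is at most [exp (- a ^ 2 / 2 s ^ 2)] times that of the normal
   law of mean [e a]. *)
Let normal_prob_half_tail (e s a : R) : s != 0 -> e ^+ 2 = 1 -> 0 <= a ->
  (normal_prob 0 s [set x | (a <= e * x)%R] <=
   (expR (- a ^+ 2 / (s ^+ 2 *+ 2)))%:E)%E.
Proof.
move=> s0 e1 a0.
have mE : measurable [set x : R | a <= e * x].
  rewrite -[X in measurable X]setTI.
  apply: (@measurable_fun_le _ _ _ setT (cst a) (fun x => e * x)) => //.
  exact: measurable_funM.
have mpdf m : measurable_fun setT (EFin \o normal_pdf m s).
  by apply/measurable_EFinP; exact: measurable_normal_pdf.
have dom x : a <= e * x ->
    normal_pdf 0 s x <= expR (- a ^+ 2 / (s ^+ 2 *+ 2)) * normal_pdf (e * a) s x.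
  move=> ax; rewrite !normal_pdfE// mulrCA ler_pM2l ?normal_peak_gt0//.
  rewrite /normal_fun -expRD ler_expR -mulrDl ler_pM2r; last first.
    by rewrite invr_gt0 mulrn_wgt0// exprn_even_gt0.
  by nra.
apply: (@le_trans _ _ (\int[lebesgue_measure]_(x in [set x : R | (a <= e * x)%R])
    ((expR (- a ^+ 2 / (s ^+ 2 *+ 2)))%:E * (normal_pdf (e * a) s x)%:E))%E).
  rewrite /normal_prob; apply: ge0_le_integral => //=.
  - by move=> x _; rewrite lee_fin normal_pdf_ge0.
  - by apply: measurable_funTS; exact: mpdf.
  - by apply: measurable_funTS; exact: (measurable_funeM _ (mpdf _)).
rewrite ge0_integralZl//=.
- rewrite -[leRHS]mule1; apply: lee_wpmul2l; first by rewrite lee_fin expR_ge0.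
  exact: (@probability_le1 _ _ _ (normal_prob (e * a) s)).
- by apply: measurable_funTS; exact: mpdf.
- by move=> x _; rewrite lee_fin normal_pdf_ge0.
Qed.

Lemma normal_prob_tail s a : s != 0 -> 0 <= a ->
  (normal_prob 0 s [set x | (a <= `|x|)%R] <=
   (2 * expR (- a ^+ 2 / (s ^+ 2 *+ 2)))%:E)%E.
Proof.
move=> s0 a0.
have mE e : measurable [set x : R | a <= e * x].
  rewrite -[X in measurable X]setTI.
  apply: (@measurable_fun_le _ _ _ setT (cst a) (fun x => e * x)) => //.
  exact: measurable_funM.
have -> : [set x : R | a <= `|x|] =
          [set x | a <= 1 * x] `|` [set x | a <= -1 * x].
  apply/seteqP; split => x /=; rewrite ler_normr mul1r mulN1r.
    by move/orP.
  by move=> ?; apply/orP.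
apply: (le_trans (measureU2 _ _ _)); [exact: mE|exact: mE|].
rewrite mulr_natl mulr2n EFinD.
by apply: leeD; apply: normal_prob_half_tail; rewrite ?expr1n ?sqrrN ?expr1n.
Qed.

(** The length of the ball times a lower bound of the density there, taken at distance [|y| + r]
    from the mean. *)
Lemma normal_prob_ball s y r : s != 0 -> 0 < r ->
  ((r *+ 2 * normal_peak s * expR (- (`|y| + r) ^+ 2 / (s ^+ 2 *+ 2)))%:E
   <= normal_prob 0 s (ball y r))%E.
Proof.
move=> s0 r0.
set c := normal_peak s * expR (- (`|y| + r) ^+ 2 / (s ^+ 2 *+ 2)).
have c0 : 0 <= c by rewrite mulr_ge0 ?normal_peak_ge0 ?expR_ge0.
have mb : measurable (ball y r) by apply: open_measurable; exact: ball_open.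
have mpdf : measurable_fun setT (EFin \o normal_pdf 0 s).
  by apply/measurable_EFinP; exact: measurable_normal_pdf.
rewrite -mulrA -/c.
have -> : ((r *+ 2 * c)%:E = \int[lebesgue_measure]_(x in ball y r) (cst c%:E x))%E.
  by rewrite integral_cst// EFinM -(lebesgue_measure_ball y (ltW r0)) muleC.
rewrite /normal_prob; apply: ge0_le_integral => //=.
- by apply: measurable_funTS; exact: mpdf.
- move=> x; rewrite /ball/= => yx; rewrite lee_fin normal_pdfE//.
  rewrite ler_pM2l ?normal_peak_gt0// /normal_fun ler_expR ler_pM2r; last first.
    by rewrite invr_gt0 mulrn_wgt0// exprn_even_gt0.
  rewrite subr0 lerN2 -(normr_id y) -real_normK ?num_real//.
  rewrite lerXn2r ?nnegrE ?addr_ge0 ?(ltW r0)// normr_id.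
  by rewrite -[x](subrK y) addrC (le_trans (ler_normD _ _))// lerD2l distrC ltW.
Qed.

End normal_bounds.

(** * Large deviations with a quadratic rate *)

Section limits_superior.
Context {R : realType}.
Implicit Types (u : nat -> \bar R) (l : \bar R).

Lemma limn_esup_le_near u l :
  (\forall n \near \oo, (u n <= l)%E) -> (limn_esup u <= l)%E.
Proof.
move=> ul; apply: (@le_trans _ _ (ereal_sup (u @` [set n | (u n <= l)%E]))).
  by apply: ereal_inf_lbound; exists [set n | (u n <= l)%E].
by apply: ge_ereal_sup => _ [n /= unl <-].
Qed.

Lemma le_limn_einf_near u l :
  (\forall n \near \oo, (l <= u n)%E) -> (l <= limn_einf u)%E.
Proof.
move=> lu; rewrite /limn_einf leeNr; apply: limn_esup_le_near.
by apply: filterS lu => n; rewrite leeN2.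
Qed.

Lemma scaled_lne_le (L : R) (p : \bar R) (n : nat) : (0 < n)%N -> (0 <= p)%E ->
  (p <= (expR (- (L * n%:R)))%:E)%E ->
  ((n%:R^-1)%:E * lne p <= (- L)%:E)%E.
Proof.
move=> n0 p0 pL; have n0R : (0 : R) < n%:R by rewrite ltr0n.
have : (lne p <= (- (L * n%:R))%:E)%E.
  rewrite -[leRHS](expeRK) lee_lne// in_itv/= leey ?andbT//.
move=> /(lee_wpmul2l (x := (n%:R^-1)%:E));
rewrite lee_fin invr_ge0 ltW// => /(_ isT).
move=> /le_trans; apply; rewrite -EFinM lee_fin mulrN mulrCA mulVf ?mulr1//.
by rewrite gt_eqF.
Qed.

Lemma scaled_lne_ge (L : R) (p : \bar R) (n : nat) : (0 < n)%N ->
  ((expR (- (L * n%:R)))%:E <= p)%E ->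
  ((- L)%:E <= (n%:R^-1)%:E * lne p)%E.
Proof.
move=> n0 pL; have n0R : (0 : R) < n%:R by rewrite ltr0n.
have p0 : (0 <= p)%E by rewrite (le_trans _ pL)// lee_fin expR_ge0.
have : ((- (L * n%:R))%:E <= lne p)%E.
  rewrite -[leLHS](expeRK) lee_lne// in_itv/= leey ?andbT//.
move=> /(lee_wpmul2l (x := (n%:R^-1)%:E));
rewrite lee_fin invr_ge0 ltW// => /(_ isT).
apply: le_trans; rewrite -EFinM lee_fin mulrN mulrCA mulVf ?mulr1//.
by rewrite gt_eqF.
Qed.

(** Constant prefactors are absorbed by any gap between exponents: [expR ((q - p) * N)] is at least
    [1 + (q - p) * N], hence at least [K] for large [N]. *)
Lemma near_scaled_expR_le (K p q : R) : p < q ->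
  \forall N \near \oo, K * expR (- (q * N%:R)) <= expR (- (p * N%:R)).
Proof.
move=> pq; apply: filterS (nbhs_infty_ger (K / (q - p))) => N.
rewrite ler_pdivrMr ?subr_gt0// => KN.
have -> : - (p * N%:R) = (q - p) * N%:R - q * N%:R :> R by ring.
rewrite [leRHS]expRD ler_pM2r ?expR_gt0//.
by apply: (le_trans _ (expR_ge1Dx _)); rewrite mulrC in KN; rewrite ler_wpDl.
Qed.

End limits_superior.

Lemma quadratic_good_rate {R : realType} (k : R) : 0 < k ->
  good_rate_function (fun y => (k * y ^+ 2)%:E).
Proof.
move=> k0; have cI : continuous (fun y : R => k * y ^+ 2).
  by move=> y; apply: cvgM; [exact: cvg_cst|exact: exprn_continuous].
split.
  split; last by move=> y; rewrite lee_fin mulr_ge0 ?sqr_ge0 ?ltW.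
  move=> x a; rewrite lte_fin => ax.
  exists [set y | a < k * y ^+ 2]; last by move=> y /=; rewrite lte_fin.
  exact: (cI _ _ (lt_nbhsr ax)).
move=> a a0; set s := Num.sqrt (a / k).
have s0 : 0 <= s by exact: sqrtr_ge0.
suff -> : [set y | ((k * y ^+ 2)%:E <= a%:E)%E] = `[- s, s]%classic.
  exact: segment_compact.
apply/seteqP; split=> y /=; rewrite in_itv/= -ler_norml lee_fin;
  rewrite mulrC -ler_pdivlMr//.
- by move=> ys; rewrite -sqrtr_sqr; exact: ler_wsqrtr.
- move=> ys; rewrite -real_normK ?num_real//.
  by rewrite -(sqr_sqrtr (divr_ge0 a0 (ltW k0))) lerXn2r ?nnegrE.
Qed.

(** * From tail and small-ball estimates to the large deviations principle *)

Section quadratic_LDP.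
Context {R : realType} {d : measure_display} {T : measurableType d}.
Variables (P : probability T R) (Z : nat -> T -> R) (k : R).
Hypothesis k0 : 0 < k.
Hypothesis mZ : forall N, (0 < N)%N -> measurable_fun setT (Z N).
Hypothesis tail : forall a L, 0 < a -> 0 <= L -> L < k * a ^+ 2 ->
  \forall N \near \oo,
    (P [set w | (a <= `|Z N w|)%R] <= (expR (- (L * N%:R)))%:E)%E.
Hypothesis local : forall y r L, 0 < r -> k * y ^+ 2 < L ->
  \forall N \near \oo,
    ((expR (- (L * N%:R)))%:E <= P (Z N @^-1` ball y r))%E.

Let mZpre N (B : set R) : (0 < N)%N -> measurable B -> measurable (Z N @^-1` B).
Proof. by move=> N0 mB; rewrite -[X in measurable X]setTI; exact: mZ. Qed.

(** For open sets, a small ball around each point suffices. For closed sets the two-sided tail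
    suffices, because the rate depends on [|y|] only and increases with it: [C] lies outside a
    centred interval with the same infimum of the rate. *)
Lemma quadratic_LDP : LDP P Z (fun y => (k * y ^+ 2)%:E).
Proof.
split; [by case: (quadratic_good_rate _ k0)|exact: mZ| |].
  move=> U oU; rewrite leeNl; apply: le_ereal_inf_tmp => _ [y Uy <-].
  rewrite leeNl; apply/lee_subgt0Pr => e e0.
  rewrite -EFinN -EFinB -opprD; apply: le_limn_einf_near.
  have [r r0 yrU] : exists2 r : R, 0 < r & ball y r `<=` U.
    by have /nbhs_ballP[r /= r0 rU] := open_nbhs_nbhs (conj oU Uy); exists r.
  have kyL : k * y ^+ 2 < k * y ^+ 2 + e by rewrite ltrDl.
  apply: filterS2 (nbhs_infty_gt 0) (local _ _ _ r0 kyL) => N N0 PN.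
  apply: scaled_lne_ge => //; apply: (le_trans PN).
  apply: le_measure; rewrite ?inE.
  - by apply: mZpre => //; apply: open_measurable; exact: ball_open.
  - by apply: mZpre => //; exact: open_measurable.
  - by move=> w /= /yrU.
move=> C cC; set X := limn_esup _.
(* Needed when the infimum is below the margin [e]: then [s - e] is negative and no exponent for
   [tail]. *)
have X0 : (X <= 0)%E.
  apply: limn_esup_le_near; apply: filterS (nbhs_infty_gt 0) => N N0.
  rewrite -[leRHS]oppe0 -EFinN; apply: scaled_lne_le => //.
  rewrite mul0r oppr0 expR0; apply: probability_le1; apply: mZpre => //.
  exact: closed_measurable.
have XL (L L' : R) : 0 <= L -> L < L' -> (forall y, C y -> L' <= k * y ^+ 2) ->
    (X <= (- L)%:E)%E.
  move=> L0 LL' CL'; apply: limn_esup_le_near.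
  have L'k : 0 < L' / k by rewrite divr_gt0// (le_lt_trans L0).
  set a := Num.sqrt (L' / k); have a0 : 0 < a by rewrite sqrtr_gt0.
  have ka : L < k * a ^+ 2 by rewrite sqr_sqrtr ?(ltW L'k)// mulrC divfK// gt_eqF.
  apply: filterS2 (nbhs_infty_gt 0) (tail _ _ a0 L0 ka) => N N0 PN.
  apply: scaled_lne_le => //; apply: le_trans PN.
  apply: le_measure; rewrite ?inE.
  - by apply: mZpre => //; exact: closed_measurable.
  - by apply: measurable_norm_ge; exact: mZ.
  - move=> w /= /CL'; rewrite mulrC -ler_pdivrMr// => h.
    by rewrite -sqrtr_sqr ler_wsqrtr.
have infI y : C y ->
    (ereal_inf [set (k * y ^+ 2)%:E | y in C] <= (k * y ^+ 2)%:E)%E.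
  by move=> Cy; apply: ereal_inf_lbound; exists y.
case: ereal_inf infI => [s| |] infI; last by rewrite leey.
- rewrite -EFinN; apply/lee_addgt0Pr => e e0; rewrite -EFinD.
  have [es|se] := leP e s; last first.
    by apply: (le_trans X0); rewrite lee_fin addrC subr_ge0 ltW.
  rewrite -[- s + e]opprK opprD opprK; apply: (XL _ s); rewrite ?subr_ge0//.
  by rewrite gtrBl.
(* An infimum [+oo] forces [C] to be empty, so [XL] holds vacuously for every exponent. *)
- suff -> : X = -oo%E by [].
  apply: eq_ninfty => r.
  apply: (@le_trans _ _ (- `|r|)%:E); last by rewrite lee_fin lerNl -normrN ler_norm.
  apply: (XL _ (`|r| + 1)) => //; first by rewrite ltrDl.
  by move=> y /infI.
Qed.

End quadratic_LDP.

(** * Transfer from a Gaussian family to an exponentially equivalent one *)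

Section gaussian_approximation.
Context {R : realType} {d : measure_display} {T : measurableType d}.
Variables (P : probability T R) (Z X : nat -> T -> R) (c h : R).
Hypotheses (c0 : c != 0) (h0 : 0 < h).
Hypothesis mZ : forall N, (0 < N)%N -> measurable_fun setT (Z N).
Hypothesis mX : forall N, measurable_fun setT (X N).
Hypothesis lawX : forall N (B : set R), (0 < N)%N -> measurable B ->
  P (X N @^-1` B) = normal_prob 0 (Num.sqrt (N%:R * h)) B.

Local Notation G N w := (c / N%:R * X N w).
Local Notation dev r N := [set w | r <= `|Z N w - G N w|].
Local Notation k := (2 * c ^+ 2 * h)^-1.

Hypothesis exponentially_equivalent : forall r L, 0 < r ->
  \forall N \near \oo, (P (dev r N) <= (expR (- (L * N%:R)))%:E)%E.

Let k0 : 0 < k.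
Proof. by rewrite invr_gt0 pmulr_lgt0// pmulr_rgt0// exprn_even_gt0. Qed.

Let mG N : measurable_fun setT (fun w => G N w).
Proof. exact: measurable_funM. Qed.

Let mdev N r : (0 < N)%N -> measurable (dev r N).
Proof.
move=> N0; apply: measurable_norm_ge.
by apply: measurable_funB; [exact: mZ|exact: mG].
Qed.

Let sd_neq0 N : (0 < N)%N -> Num.sqrt (N%:R * h) != 0.
Proof. by move=> N0; rewrite gt_eqF// sqrtr_gt0 mulr_gt0// ltr0n. Qed.

Let var N : Num.sqrt (N%:R * h) ^+ 2 = N%:R * h.
Proof. by rewrite sqr_sqrtr// mulr_ge0 ?ler0n// ltW. Qed.

Let normc : 0 < `|c|. Proof. by rewrite normr_gt0. Qed.

Let normG N w : (0 < N)%N -> `|G N w| = `|c| / N%:R * `|X N w|.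
Proof. by move=> N0; rewrite !normrM normfV (ger0_norm (ler0n _ _)). Qed.

(** The event [|G| >= a] is [|X| >= a * N / |c|], and [X] has variance [N * h]: the exponent becomes
    linear in [N], with slope the rate at [a]. *)
Let tail_exponent N (a : R) : (0 < N)%N ->
  - (a * N%:R / `|c|) ^+ 2 / (Num.sqrt (N%:R * h) ^+ 2 *+ 2)
  = - (k * a ^+ 2 * N%:R).
Proof.
move=> N0; rewrite var -(real_normK (num_real c)) -mulr_natr.
by field; rewrite !gt_eqF ?ltr0n.
Qed.

Let tailG N (a : R) : (0 < N)%N -> 0 <= a ->
  (P [set w | (a <= `|G N w|)%R] <= (2 * expR (- (k * a ^+ 2 * N%:R)))%:E)%E.
Proof.
move=> N0 a0; have N0R : (0 : R) < N%:R by rewrite ltr0n.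
rewrite -tail_exponent//.
have -> : [set w | a <= `|G N w|] =
          X N @^-1` [set x | a * N%:R / `|c| <= `|x|].
  apply/seteqP; split=> w /=; rewrite normG// ler_pdivrMr//.
    by rewrite mulrAC ler_pdivlMr// mulrC => /le_trans; apply; rewrite mulrC.
  by rewrite mulrAC ler_pdivlMr// [X in _ -> _ <= X]mulrC.
rewrite lawX//; last first.
  exact: (@measurable_norm_ge R _ R id _ (@measurable_id _ _ _)).
apply: normal_prob_tail; first exact: sd_neq0.
by rewrite divr_ge0// mulr_ge0// ltW.
Qed.

(** In terms of [X] the radius grows like [N] and the standard deviation like [sqrt N]. The
    prefactor is therefore a constant times [sqrt N >= 1], and the constant serves as [K]. *)
Let localG (y r : R) : 0 < r -> exists2 K, 0 < K &
  forall N, (0 < N)%N ->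
    ((K * expR (- (k * (`|y| + r) ^+ 2 * N%:R)))%:E
     <= P ((fun w => G N w) @^-1` ball y r))%E.
Proof.
move=> r0; set q := Num.sqrt (h * pi *+ 2).
have hpi : 0 < h * pi *+ 2 :> R by rewrite mulrn_wgt0// mulr_gt0// pi_gt0.
have q0 : 0 < q by rewrite sqrtr_gt0.
exists (r *+ 2 / `|c| / q); first by rewrite !divr_gt0// mulrn_wgt0.
move=> N N0; have N0R : (0 : R) < N%:R by rewrite ltr0n.
have -> : (fun w => G N w) @^-1` ball y r =
          X N @^-1` ball (y * N%:R / c) (r * N%:R / `|c|).
  apply/seteqP; split=> w; rewrite /ball/= ltr_pdivlMr// -normrM;
    rewrite (_ : (_ - _) * c = (y - G N w) * N%:R)
      ?normrM ?(ger0_norm (ltW N0R)) ?ltr_pM2r//;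
    by field; rewrite c0 gt_eqF.
rewrite lawX//; last by apply: open_measurable; exact: ball_open.
apply: le_trans (normal_prob_ball _ _ _ (sd_neq0 N N0) _); last first.
  by rewrite divr_gt0 ?mulr_gt0.
have -> : `|y * N%:R / c| + r * N%:R / `|c| = (`|y| + r) * N%:R / `|c|.
  by rewrite !normrM normfV (ger0_norm (ltW N0R)) !mulrDl.
rewrite tail_exponent// lee_fin ler_pM2r ?expR_gt0// /normal_peak var.
have -> : N%:R * h * pi *+ 2 = N%:R * (h * pi *+ 2) by ring.
rewrite sqrtrM ?ler0n// -/q invfM.
have -> : (r * N%:R / `|c|) *+ 2 * ((Num.sqrt N%:R)^-1 / q) =
          r *+ 2 / `|c| / q * (N%:R / Num.sqrt N%:R).
  by field; rewrite !gt_eqF// sqrtr_gt0.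
apply: ler_peMr; first by rewrite ltW// !divr_gt0// mulrn_wgt0.
rewrite ler_pdivlMr ?sqrtr_gt0// mul1r -[leRHS]sqr_sqrtr ?ler0n//.
by rewrite expr2 ler_peMr ?sqrtr_ge0// -[leLHS]sqrtr1 ler_wsqrtr// ler1n.
Qed.

(** [b ^+ 2] is the midpoint of [L / k] and [y ^+ 2]. This leaves room both in space, to absorb the
    deviation of [Z] from [G], and in the exponent, to absorb constants. *)
Let midpoint (y L : R) : 0 <= y -> 0 <= L -> exists b,
  [/\ 0 <= b, (L < k * y ^+ 2 -> b < y /\ L < k * b ^+ 2) &
              (k * y ^+ 2 < L -> y < b /\ k * b ^+ 2 < L)].
Proof.
move=> y0 L0; exists (Num.sqrt ((L / k + y ^+ 2) / 2)).
have m0 : 0 <= (L / k + y ^+ 2) / 2.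
  by rewrite divr_ge0// addr_ge0 ?sqr_ge0// divr_ge0// ltW.
have kb : k * Num.sqrt ((L / k + y ^+ 2) / 2) ^+ 2 = (L + k * y ^+ 2) / 2.
  by rewrite sqr_sqrtr//; field; rewrite c0 gt_eqF.
split; first exact: sqrtr_ge0.
- move=> Lk; split; last by rewrite kb; lra.
  rewrite -(ltr_pXn2r (n := 2))// ?nnegrE ?sqrtr_ge0// -(ltr_pM2l k0) kb; lra.
- move=> Lk; split; last by rewrite kb; lra.
  rewrite -(ltr_pXn2r (n := 2))// ?nnegrE ?sqrtr_ge0// -(ltr_pM2l k0) kb; lra.
Qed.

Lemma gaussian_approximation_LDP : LDP P Z (fun y => (k * y ^+ 2)%:E).
Proof.
apply: quadratic_LDP => //.
- move=> a L a0 L0 La; have [b [b0 /(_ La)[ba Lb] _]] := midpoint _ _ (ltW a0) L0.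
  have ab0 : 0 < a - b by rewrite subr_gt0.
  have dev_le := exponentially_equivalent _ (k * b ^+ 2) ab0.
  (* The factor 3 collects 2 from the Gaussian tail at [b] and 1 from the deviation event at
     [a - b]. *)
  apply: filterS3 (nbhs_infty_gt 0) dev_le (near_scaled_expR_le 3 _ _ Lb).
  move=> N N0 dN le3.
  apply: (@le_trans _ _ (P ([set w | b <= `|G N w|] `|` dev (a - b) N))).
    apply: le_measure; rewrite ?inE.
    + by apply: measurable_norm_ge; exact: mZ.
    + by apply: measurableU; [exact: measurable_norm_ge|exact: mdev].
    + move=> w /= aZ; have [bG|Gb] := leP b `|G N w|; [by left|right].
      by have := ler_normD (Z N w - G N w) (G N w); rewrite subrK; lra.
  apply: (le_trans (measureU2 _ _ _)); [exact: measurable_norm_ge|exact: mdev|].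
  apply: (le_trans (leeD (tailG _ _ N0 b0) dN)).
  by rewrite -EFinD lee_fin; lra.
- move=> y r L r0; rewrite -(real_normK (num_real y)) => yL.
  have L0 : 0 <= L by rewrite ltW// (le_lt_trans _ yL)// mulr_ge0 ?sqr_ge0 ?ltW.
  have [b [b0 _ /(_ yL)[yb bL]]] := midpoint _ _ (normr_ge0 y) L0.
  (* The first bound puts [Z] in the ball of radius [r] when it deviates from [G] by less than
     [r / 2]; the second keeps the exponent of [localG] below that at [b]. *)
  set e := Num.min (r / 2) (b - `|y|).
  have e0 : 0 < e by rewrite lt_min divr_gt0// subr_gt0.
  have er : e <= r / 2 by rewrite ge_min lexx.
  have eb : `|y| + e <= b by rewrite -lerBrDl ge_min lexx orbT.
  have [K K0 GK] := localG y e e0.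
  have r20 : 0 < r / 2 by rewrite divr_gt0.
  (* With [2 / K] the Gaussian ball has probability at least twice [expR (- (L * N))]; subtracting
     the deviation event leaves one copy. *)
  apply: filterS3 (nbhs_infty_gt 0) (exponentially_equivalent _ L r20)
    (near_scaled_expR_le (2 / K) _ _ bL) => N N0 dN le2.
  have mZb : measurable (Z N @^-1` ball y r).
    rewrite -[X in measurable X]setTI; apply: mZ => //.
    by apply: open_measurable; exact: ball_open.
  have mGb : measurable ((fun w => G N w) @^-1` ball y e).
    rewrite -[X in measurable X]setTI; apply: mG => //.
    by apply: open_measurable; exact: ball_open.
  have : (P ((fun w => G N w) @^-1` ball y e) <=
          P (Z N @^-1` ball y r) + P (dev (r / 2)%R N))%E.
    apply: le_trans (measureU2 _ _ _) => //; last exact: mdev.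
    apply: le_measure; rewrite ?inE//.
      by apply: measurableU => //; exact: mdev.
    move=> w /=; rewrite /ball/= => yG.
    have [rZ|Zr] := lerP (r / 2) `|Z N w - G N w|; [by right|left].
    by have := ler_distD (G N w) y (Z N w); rewrite (distrC (G N w)); lra.
  move=> /(le_trans (GK N N0)) /le_trans /(_ (leeD (lexx _) dN)).
  rewrite -(fineK (fin_num_measure P _ mZb)) -EFinD !lee_fin.
  move=> pK.
  have {}le2 : 2 * expR (- (L * N%:R)) <= K * expR (- (k * b ^+ 2 * N%:R)).
    by rewrite -ler_pdivrMl// mulrA (mulrC K^-1).
  suff ebN : expR (- (k * b ^+ 2 * N%:R)) <=
             expR (- (k * (`|y| + e) ^+ 2 * N%:R)).
    by have := ler_wpM2l (ltW K0) ebN; lra.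
  rewrite ler_expR lerN2 ler_pM2r ?ltr0n// ler_pM2l//.
  by rewrite lerXn2r ?nnegrE ?addr_ge0 ?(ltW e0).
Qed.

End gaussian_approximation.

(** * The mean position *)

Lemma det2E (R : comNzRingType) (A : 'M[R]_2) :
  \det A = A 0 0 * A 1 1 - A 0 1 * A 1 0.
Proof.
rewrite (expand_det_row _ 0) !big_ord_recl big_ord0 addr0 /cofactor !det_mx11 !mxE.
rewrite expr0 mul1r expr1 mulN1r mulrN.
by congr (_ * A _ _ - A _ _ * A _ _); apply/val_inj.
Qed.

Lemma trace2E (R : nmodType) (A : 'M[R]_2) : \tr A = A 0 0 + A 1 1.
Proof.
rewrite /mxtrace !big_ord_recl big_ord0 addr0.
by congr (_ + A _ _); apply/val_inj.
Qed.

Section method_coordinates.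
Variables (R : realType) (T : Type) (W : R -> T -> R) (alpha h : R).
Variables (A : 'M[R]_2) (b : 'cV[R]_2) (z : 'cV[R]_2).

Lemma method_step (i : 'I_2) n w : method W alpha h A b z n.+1 w i 0 =
  A i 0 * position W alpha h A b z n w + A i 1 * momentum W alpha h A b z n w
  + alpha * b i 0 * increment W h n w.
Proof.
rewrite /= !mxE !big_ord_recl big_ord0 addr0 mulrAC /position /momentum.
by have -> : lift ord0 ord0 = 1 :> 'I_2 by exact: val_inj.
Qed.

Lemma sum_increment N w :
  \sum_(0 <= n < N) increment W h n w = W (N%:R * h) w - W (0%:R * h) w.
Proof. exact: (telescope_sumr (fun n => W (n%:R * h) w)). Qed.

End method_coordinates.

Lemma det_id_subE (R : comNzRingType) (A : 'M[R]_2) :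
  1 - \tr A + \det A = (1 - A 0 0) * (1 - A 1 1) - A 0 1 * A 1 0.
Proof. by rewrite trace2E det2E; ring. Qed.

(** [4 * (1 - tr A + det A)] is [(2 - tr A) ^+ 2] plus the discriminant of (A1). *)
Lemma det_id_sub_gt0 (R : realFieldType) (A : 'M[R]_2) :
  0 < 4 * \det A - (\tr A) ^+ 2 -> 0 < 1 - \tr A + \det A.
Proof. by have := sqr_ge0 (2 - \tr A); lra. Qed.

Lemma mean_position_decomposition {R : realType} {T : Type} (W : R -> T -> R)
    (alpha h : R) (A : 'M[R]_2) (b z : 'cV[R]_2) :
  condA1 A -> condA3 A ->
  let c := alpha * (b 0 0 + A 0 1 * b 1 0 - A 1 1 * b 0 0)
           / (1 - \tr A + \det A) in
  exists2 K, 0 < K & forall N w M, (0 < N)%N -> 0 <= M ->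
    (forall j, (j < N)%N -> increment W h j w ^+ 2 <= M) ->
    (N%:R * (mean_position W alpha h A b z N w
             - c / N%:R * (W (N%:R * h) w - W (0%:R * h) w))) ^+ 2
    <= K * (1 + M).
Proof.
move=> A1 A3 c; have p0 := det_id_sub_gt0 _ _ A1.
set p := 1 - \tr A + \det A in p0 c *.
rewrite /condA1 /condA3 trace2E det2E in A1 A3.
set x0 := z 0 0; set y0 := z 1 0.
have [K K0 zK] := planar_recursion_bound _ _ _ _ _ A1 A3
  (alpha * b 0 0) (alpha * b 1 0) x0 y0.
(* [l] is the Cauchy-Schwarz constant of the functional of [z_0 - z_N]; [Q] bounds the squared
   length of that difference through [(s - t) ^+ 2 <= 2 * s ^+ 2 + 2 * t ^+ 2]. *)
set l := ((1 - A 1 1) ^+ 2 + A 0 1 ^+ 2) / p ^+ 2.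
have l0 : 0 <= l by rewrite divr_ge0 ?sqr_ge0// addr_ge0 ?sqr_ge0.
set Q := 2 * (x0 ^+ 2 + y0 ^+ 2 + K).
have Q0 : 0 < Q by rewrite mulr_gt0// ltr_wpDl// addr_ge0 ?sqr_ge0.
exists (l * Q + 1); first by rewrite ltr_wpDl// mulr_ge0// ltW.
move=> N w M N0 M0 wM; have N0R : N%:R != 0 :> R by rewrite pnatr_eq0 -lt0n.
pose x n := position W alpha h A b z n w.
pose y n := momentum W alpha h A b z n w.
have xS n : x n.+1 = A 0 0 * x n + A 0 1 * y n
    + alpha * b 0 0 * increment W h n w by exact: method_step.
have yS n : y n.+1 = A 1 0 * x n + A 1 1 * y n
    + alpha * b 1 0 * increment W h n w by exact: method_step.
have xyN := zK x y (increment W h ^~ w) erefl erefl xS yS N M wM M0.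
have := planar_recursion_sum _ _ _ _ _ _ _ _ _ _ xS yS N.
rewrite sum_increment -det_id_subE -/p => sumx.
have -> : N%:R * (mean_position W alpha h A b z N w
    - c / N%:R * (W (N%:R * h) w - W (0%:R * h) w)) =
    ((1 - A 1 1) * (x0 - x N) + A 0 1 * (y0 - y N)) / p.
  apply: (mulIf (lt0r_neq0 p0)); rewrite divfK ?lt0r_neq0//.
  have -> : (1 - A 1 1) * (x0 - x N) + A 0 1 * (y0 - y N) =
      p * \sum_(0 <= n < N) x n
      - ((1 - A 1 1) * (alpha * b 0 0) + A 0 1 * (alpha * b 1 0))
        * (W (N%:R * h) w - W (0%:R * h) w).
    by rewrite sumx (_ : x 0 = x0)// (_ : y 0 = y0)//; ring.
  rewrite /mean_position -/x /c; field.
  by rewrite N0R gt_eqF.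
have cauchy_schwarz (s t u v : R) :
    (s * u + t * v) ^+ 2 <= (s ^+ 2 + t ^+ 2) * (u ^+ 2 + v ^+ 2).
  by have := sqr_ge0 (s * v - t * u); lra.
have uv : (x0 - x N) ^+ 2 + (y0 - y N) ^+ 2 <= Q * (1 + M).
  have := sqr_ge0 (x0 + x N); have := sqr_ge0 (y0 + y N).
  have := mulr_ge0 (addr_ge0 (sqr_ge0 x0) (sqr_ge0 y0)) M0.
  by rewrite /Q; nra.
rewrite expr_div_n ler_pdivrMr ?exprn_gt0//.
apply: (le_trans (cauchy_schwarz _ _ _ _)).
have -> : (1 - A 1 1) ^+ 2 + A 0 1 ^+ 2 = l * p ^+ 2.
  by rewrite divfK// expf_neq0// gt_eqF.
rewrite mulrAC ler_pM2r ?exprn_gt0//.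
by have := ler_wpM2l l0 uv; lra.
Qed.

(** * Brownian increments and the large deviations of the mean position *)

Section brownian_increments.
Context {R : realType} {d : measure_display} {T : measurableType d}.
Variables (P : probability T R) (F : R -> set_system T) (W : R -> T -> R).
Hypotheses (hF : filtration F) (hW : brownian_motion P F W).
Variable h : R.
Hypothesis h0 : 0 < h.

Let time_ge0 n : 0 <= n%:R * h.
Proof. by rewrite mulr_ge0 ?ler0n// ltW. Qed.

Lemma measurable_brownian t : 0 <= t -> measurable_fun setT (W t).
Proof.
move=> t0 _ B mB; rewrite setTI.
have [Wm _ _ _ _] := hW; have [Fm _] := hF.
exact: (proj2 (Fm t t0)) _ (Wm t t0 B mB).
Qed.

Lemma measurable_increment n : measurable_fun setT (increment W h n).
Proof. by apply: measurable_funB; exact: measurable_brownian. Qed.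

Let increment_tail n (a : R) : 0 <= a ->
  (P [set w | (a <= `|increment W h n w|)%R]
   <= (2 * expR (- a ^+ 2 / (h *+ 2)))%:E)%E.
Proof.
move=> a0; have [_ _ _ _ lawW] := hW.
have nn : n%:R * h < n.+1%:R * h by rewrite ltr_pM2r// ltr_nat.
have mB : measurable [set x : R | a <= `|x|].
  exact: (@measurable_norm_ge R _ R id a (@measurable_id _ _ _)).
have -> : [set w | a <= `|increment W h n w|] =
    (W (n.+1%:R * h) \- W (n%:R * h)) @^-1` [set x : R | a <= `|x|] by [].
rewrite lawW// -mulrBl -natrB// subSnn mul1r.
have := normal_prob_tail (Num.sqrt h) a; rewrite sqr_sqrtr ?(ltW h0)//; apply=> //.
by rewrite gt_eqF// sqrtr_gt0.
Qed.

(** The threshold is linear in [N], the scale on which the boundary term matters; only the first [N]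
    increments enter [z_N]. *)
Definition large_increment (e : R) (N : nat) : set T :=
  \big[setU/set0]_(j < N) [set w | e * N%:R <= `|increment W h j w|].

Lemma measurable_large_increment e N : measurable (large_increment e N).
Proof.
apply: bigsetU_measurable => j _.
by apply: measurable_norm_ge; exact: measurable_increment.
Qed.

Lemma increment_small e N w j : ~ large_increment e N w -> (j < N)%N ->
  `|increment W h j w| < e * N%:R.
Proof.
move=> nw jN; rewrite ltNge; apply/negP => le.
apply: nw; rewrite /large_increment.
rewrite -(bigcup_mkord N (fun i => [set w | e * N%:R <= `|increment W h i w|])).
by exists j.
Qed.

Lemma large_increment_negligible (e L : R) : 0 < e ->
  \forall N \near \oo,
    (P (large_increment e N) <= (expR (- (L * N%:R)))%:E)%E.
Proof.
move=> e0; set k := e ^+ 2 / (h *+ 2).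
have k0 : 0 < k by rewrite divr_gt0 ?exprn_gt0// mulrn_wgt0.
(* The union bound gives [2 * N * expR (- (k * N ^+ 2))]. As [2 * N <= expR (2 * N)], it is enough
   that [k * N >= L + 2]. *)
apply: filterS2 (nbhs_infty_gt 0) (nbhs_infty_ger ((L + 2) / k)) => N N0.
rewrite ler_pdivrMr// => Nk.
apply: (le_trans (@Boole_inequality _ _ _ P
  (fun j => [set w | e * N%:R <= `|increment W h j w|]) N _)).
  by move=> j _; apply: measurable_norm_ge; exact: measurable_increment.
apply: (@le_trans _ _ (\sum_(j < N) (2 * expR (- (e * N%:R) ^+ 2 / (h *+ 2)))%:E)%E).
  by apply: lee_sum => j _; apply: increment_tail; rewrite mulr_ge0// ltW.
rewrite sumEFin lee_fin sumr_const card_ord -[leLHS]mulr_natl mulrA.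
apply: (@le_trans _ _ (expR (N%:R * 2) * expR (- (e * N%:R) ^+ 2 / (h *+ 2)))).
  by rewrite ler_pM2r ?expR_gt0// (le_trans _ (expR_ge1Dx _))// lerDr.
rewrite -expRD ler_expR.
have -> : - (e * N%:R) ^+ 2 / (h *+ 2) = - (k * N%:R) * N%:R.
  by rewrite /k; field; rewrite gt_eqF.
have N0R : (0 : R) < N%:R by rewrite ltr0n.
by have := ler_wpM2r (ltW N0R) Nk; lra.
Qed.

Variables (alpha : R) (A : 'M[R]_2) (b : 'cV[R]_2) (z : 'cV[R]_2).

Lemma measurable_method n i :
  measurable_fun setT (fun w => method W alpha h A b z n w i 0).
Proof.
elim: n i => [|n IH] i; first exact: measurable_cst.
rewrite (_ : (fun w => _) = (fun w =>
  A i 0 * position W alpha h A b z n w + A i 1 * momentum W alpha h A b z n w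
  + alpha * b i 0 * increment W h n w)); last first.
  by apply/funext => w; rewrite method_step.
apply: measurable_funD; first apply: measurable_funD; apply: measurable_funM => //.
- exact: IH.
- exact: IH.
- exact: measurable_increment.
Qed.

Lemma measurable_mean_position N :
  measurable_fun setT (mean_position W alpha h A b z N).
Proof.
apply: measurable_funM => //; apply: measurable_sum => n.
exact: measurable_method.
Qed.

Hypotheses (alpha0 : 0 < alpha) (A1 : condA1 A) (A3 : condA3 A) (A4 : condA4 A b).

Lemma mean_position_LDP :
  good_rate_function (fun y => (method_rate alpha h A b y)%:E) /\
  LDP P (mean_position W alpha h A b z)
    (fun y => (method_rate alpha h A b y)%:E).
Proof.
have p0 := det_id_sub_gt0 _ _ A1.
set c := alpha * (b 0 0 + A 0 1 * b 1 0 - A 1 1 * b 0 0) / (1 - \tr A + \det A).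
have c0 : c != 0.
  apply: mulf_neq0; last by rewrite invr_eq0 lt0r_neq0.
  by apply: mulf_neq0 => //; rewrite lt0r_neq0.
have -> : (fun y => (method_rate alpha h A b y)%:E) =
          (fun y => ((2 * c ^+ 2 * h)^-1 * y ^+ 2)%:E).
  apply/funext => y; congr EFin; rewrite /method_rate /c; field.
  by apply/and4P; split=> //; rewrite lt0r_neq0.
split.
  apply: quadratic_good_rate.
  by rewrite invr_gt0 pmulr_lgt0// pmulr_rgt0// exprn_even_gt0.
apply: (gaussian_approximation_LDP P _
  (fun N w => W (N%:R * h) w - W (0%:R * h) w) c h c0 h0).
- by move=> N _; exact: measurable_mean_position.
- by move=> N; apply: measurable_funB; exact: measurable_brownian.
- move=> N B N0 mB; have [_ _ _ _ lawW] := hW.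
  have N0h : 0%:R * h < N%:R * h by rewrite ltr_pM2r// ltr_nat.
  have := lawW _ _ (time_ge0 0) N0h B mB.
  by rewrite (_ : N%:R * h - 0%:R * h = N%:R * h)//; ring.
move=> r L r0.
have [K K0 KP] := mean_position_decomposition W alpha h A b z A1 A3.
(* Then [K * (e * N) ^+ 2] is half of [(r * N) ^+ 2], and the lower bound on [N] chosen below makes
   the remaining [K] smaller than the other half. *)
set e := r / Num.sqrt (2 * K).
have sK : 0 < Num.sqrt (2 * K) by rewrite sqrtr_gt0 mulr_gt0.
have e0 : 0 < e by rewrite divr_gt0.
apply: filterS3 (nbhs_infty_gt 0) (nbhs_infty_ger (2 * K / r ^+ 2 + 1))
  (large_increment_negligible e L e0) => N N0 NK PN.
apply: le_trans PN; apply: le_measure; rewrite ?inE.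
- apply: measurable_norm_ge; apply: measurable_funB.
    exact: measurable_mean_position.
  apply: measurable_funM => //.
  by apply: measurable_funB; exact: measurable_brownian.
- exact: measurable_large_increment.
move=> w /= rw; apply: contrapT => small.
have N0R : (0 : R) < N%:R by rewrite ltr0n.
have := KP N w ((e * N%:R) ^+ 2) N0 (sqr_ge0 _).
have smallM j : (j < N)%N -> increment W h j w ^+ 2 <= (e * N%:R) ^+ 2.
  move=> jN; rewrite -real_normK ?num_real//; apply: lerXn2r.
  - by rewrite nnegrE.
  - by rewrite nnegrE mulr_ge0// ltW.
  - by rewrite ltW// increment_small.
move=> /(_ smallM); rewrite leNgt => /negP; apply.
have eE : K * (e * N%:R) ^+ 2 = r ^+ 2 * N%:R ^+ 2 / 2.
  rewrite exprMn /e expr_div_n sqr_sqrtr ?mulr_ge0 ?(ltW K0)//.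
  by field; rewrite gt_eqF.
rewrite mulrDr eE mulr1 exprMn.
rewrite -(real_normK (num_real (mean_position _ _ _ _ _ _ _ _ - _))).
have rw2 : r ^+ 2 <= `|mean_position W alpha h A b z N w
    - c / N%:R * (W (N%:R * h) w - W (0%:R * h) w)| ^+ 2.
  by rewrite lerXn2r ?nnegrE ?(ltW r0).
have := ler_wpM2l (sqr_ge0 N%:R) rw2.
have r20 : 0 < r ^+ 2 by rewrite exprn_gt0.
have KrN : 2 * K < r ^+ 2 * N%:R.
  by rewrite -ltr_pdivrMl// mulrC (lt_le_trans _ NK)// ltrDl.
have N1 : (1 : R) <= N%:R by rewrite ler1n.
have := ler_wpM2l (ltW (mulr_gt0 r20 N0R)) N1.
by rewrite expr2; lra.
Qed.

End brownian_increments.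

(** * Symplecticity and the small step limit *)

Section symplecticity.
Context {R : realType}.

Global Instance is_diff_coord {m n : nat} (i : 'I_m.+1) (j : 'I_n.+1)
    (M : 'M[R]_(m.+1, n.+1)) :
  is_diff M (fun N : 'M[R]_(m.+1, n.+1) => N i j : R) (fun N => N i j).
Proof.
have @f : {linear 'M[R]_(m.+1, n.+1) -> R}.
  by exists (fun N : 'M[R]_(_, _) => N i j); do 2![eexists]; do ?[constructor];
     rewrite ?mxE// => ? *; rewrite ?mxE//; move=> ?; rewrite !mxE.
split; first exact: differentiable_coord.
by rewrite [LHS](diff_lin (f := f))//; exact: coord_continuous.
Qed.

(** Shape of one step as a function of the initial value: the noise enters [r] only, so it
    disappears on differentiation. *)
Definition affine2 (p q r : R) (z : 'cV[R]_2) : R := p * z 0 0 + q * z 1 0 + r.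

Lemma diff_affine2 (p q r : R) (z u : 'cV[R]_2) :
  'd (affine2 p q r) z u = p * u 0 0 + q * u 1 0.
Proof.
pose x (i : 'I_2) (z : 'cV[R]_2) : R := z i 0.
have xd i : is_diff z (x i) (x i) by exact: is_diff_coord.
have px : is_diff z (p *: x 0) (p *: x 0) := is_diffZ p (xd 0).
have qx : is_diff z (q *: x 1) (q *: x 1) := is_diffZ q (xd 1).
have pqx : is_diff z (p *: x 0 + q *: x 1) (p *: x 0 + q *: x 1) := is_diffD px qx.
have [_ pqr] := is_diffD pqx (is_diff_cst r z).
have -> : affine2 p q r = p *: x 0 + q *: x 1 + cst r by [].
by rewrite pqr addr0.
Qed.

Lemma wedge_d_affine2 (p q r p' q' r' : R) (z u v : 'cV[R]_2) :
  wedge_d (affine2 p q r) (affine2 p' q' r') z u v =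
  (p * q' - q * p') * (u 0 0 * v 1 0 - v 0 0 * u 1 0).
Proof.
rewrite /wedge_d !diff_affine2.
move: (u 0 0) (u 1 0) (v 0 0) (v 1 0) => u0 u1 v0 v1; ring.
Qed.

(** The first step already violates the condition: on the two unit vectors the form goes from 1 to
    [\det A]. *)
Lemma not_symplectic_method (d : measure_display) (T : measurableType d)
    (P : probability T R) (W : R -> T -> R) (alpha h : R)
    (A : 'M[R]_2) (b : 'cV[R]_2) :
  \det A != 1 -> ~ symplectic_method P W alpha h A b.
Proof.
move=> detA sym.
(* An almost sure property holds for some outcome, since the whole space is not negligible. *)
have [w wedge] : exists w, forall (n : nat) (z0 u v : 'cV[R]_2),
    wedge_d (fun z => position W alpha h A b z n.+1 w)
      (fun z => momentum W alpha h A b z n.+1 w) z0 u v =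
    wedge_d (fun z => position W alpha h A b z n w)
      (fun z => momentum W alpha h A b z n w) z0 u v.
  apply: contrapT => /forallNP none.
  have : P.-negligible setT by apply: negligibleS sym => w _; exact: none.
  move=> /(measure_negligible measurableT) PT0.
  have : P setT = 1%E := probability_setT P.
  by rewrite [LHS]PT0 => /esym/eqP; rewrite onee_eq0.
have := wedge 0 0 (vec2 1 0) (vec2 0 1).
have -> : (fun z => position W alpha h A b z 0 w) = affine2 1 0 0.
  by apply/funext => z; rewrite /affine2 /position/=; ring.
have -> : (fun z => momentum W alpha h A b z 0 w) = affine2 0 1 0.
  by apply/funext => z; rewrite /affine2 /momentum/=; ring.
have -> : (fun z => position W alpha h A b z 1 w) =
    affine2 (A 0 0) (A 0 1) (alpha * b 0 0 * increment W h 0 w).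
  by apply/funext => z; exact: method_step.
have -> : (fun z => momentum W alpha h A b z 1 w) =
    affine2 (A 1 0) (A 1 1) (alpha * b 1 0 * increment W h 0 w).
  by apply/funext => z; exact: method_step.
rewrite !wedge_d_affine2 -det2E.
have [-> -> -> ->] : [/\ vec2 1 0 0 0 = 1 :> R, vec2 1 0 1 0 = 0 :> R,
    vec2 0 1 0 0 = 0 :> R & vec2 0 1 1 0 = 1 :> R] by split; rewrite mxE.
by rewrite !mulr1 !mulr0 !subr0 !mulr1 => detE; rewrite detE eqxx in detA.
Qed.

End symplecticity.

Section small_step_limit.
Context {R : realType}.

(** One power of [h] is left over: the quotient is at most [C * h]. The function [f] is a sum of
    errors, and [g] any one of them. *)
Lemma bigO_pow_cvg0 (f g : R -> R) (p : nat) : bigO_pow f p.+1 ->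
  (forall h, `|g h| <= f h) -> g h / h ^+ p @[h --> 0^'+] --> 0.
Proof.
move=> [C fC] gf; apply/norm_cvg0P.
apply: (@squeeze_cvgr _ _ _ _ (cst 0) (fun h => C * h)).
- apply: filterS2 fC (nbhs_right_gt 0) => h fCh h0; rewrite normr_ge0/=.
  rewrite normrM normfV (ger0_norm (exprn_ge0 _ (ltW h0))).
  rewrite ler_pdivrMr ?exprn_gt0// -mulrA -exprS.
  by apply: (le_trans (gf h)); apply: le_trans fCh; exact: ler_norm.
- exact: cvg_cst.
- rewrite -[X in _ --> X](mulr0 C); apply: cvgM; first exact: cvg_cst.
  apply: cvg_at_right_filter.
  exact: cvg_id.
Qed.

Lemma modified_rate_cvg (alpha : R) (A : R -> 'M[R]_2) (b : R -> 'cV[R]_2)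
    (y : R) : condB A b ->
  modified_rate alpha h (A h) (b h) y @[h --> 0^'+] -->
  y ^+ 2 / (2 * alpha ^+ 2).
Proof.
move=> [BA Bb].
have a11 : (A h 0 0 - 1) / h ^+ 1 @[h --> 0^'+] --> 0.
  apply: (bigO_pow_cvg0 _ _ _ BA) => h.
  by rewrite -!addrA lerDl !addr_ge0.
have a22 : (A h 1 1 - 1) / h ^+ 1 @[h --> 0^'+] --> 0.
  apply: (bigO_pow_cvg0 _ _ _ BA) => h.
  by rewrite -addrA addrAC lerDr !addr_ge0.
have a12 : (A h 0 1 - h) / h ^+ 1 @[h --> 0^'+] --> 0.
  apply: (bigO_pow_cvg0 _ _ _ BA) => h.
  by rewrite addrAC lerDr !addr_ge0.
have a21 : (A h 1 0 + h) / h ^+ 1 @[h --> 0^'+] --> 0.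
  apply: (bigO_pow_cvg0 _ _ _ BA) => h.
  by rewrite lerDr !addr_ge0.
have b1 : b h 0 0 / h ^+ 0 @[h --> 0^'+] --> 0.
  by apply: (bigO_pow_cvg0 _ _ _ Bb) => h; rewrite lerDl.
have b2 : (b h 1 0 - 1) / h ^+ 0 @[h --> 0^'+] --> 0.
  by apply: (bigO_pow_cvg0 _ _ _ Bb) => h; rewrite lerDr.
(* [num] is det(I - A) over [h ^+ 2] and [den] is [b_1 + a_12 b_2 - a_22 b_1] over [h], written in
   rescaled errors that tend to 0. *)
pose num h := ((A h 0 0 - 1) / h ^+ 1) * ((A h 1 1 - 1) / h ^+ 1)
  - ((A h 0 1 - h) / h ^+ 1 + 1) * ((A h 1 0 + h) / h ^+ 1 - 1).
pose den h := ((A h 0 1 - h) / h ^+ 1 + 1) * ((b h 1 0 - 1) / h ^+ 0 + 1)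
  - (b h 0 0 / h ^+ 0) * ((A h 1 1 - 1) / h ^+ 1).
have c1 : (fun=> 1) @ (0 : R)^'+ --> (1 : R) by exact: cvg_cst.
have num1 : num h @[h --> 0^'+] --> (1 : R).
  rewrite (_ : 1 = 0 * 0 - (0 + 1) * (0 - 1) :> R); last by ring.
  exact: (cvgB (cvgM a11 a22) (cvgM (cvgD a12 c1) (cvgB a21 c1))).
have den1 : den h @[h --> 0^'+] --> (1 : R).
  rewrite (_ : 1 = (0 + 1) * (0 + 1) - 0 * 0 :> R); last by ring.
  exact: (cvgB (cvgM (cvgD a12 c1) (cvgD b2 c1)) (cvgM b1 a22)).
have lim : y ^+ 2 / (2 * alpha ^+ 2) * ((num h / den h) * (num h / den h))
    @[h --> 0^'+] -->
    y ^+ 2 / (2 * alpha ^+ 2) * ((1 / 1) * (1 / 1)).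
  have ratio : num h / den h @[h --> 0^'+] --> (1 / 1 : R).
    exact: (cvgM num1 (cvgV (oner_neq0 _) den1)).
  by apply: cvgM; [exact: cvg_cst|exact: (cvgM ratio ratio)].
rewrite divr1 !mulr1 in lim; apply: cvg_trans lim; apply: near_eq_cvg.
apply: filterS (nbhs_right_gt 0) => h h0.
rewrite /modified_rate /method_rate det_id_subE.
have -> : (1 - A h 0 0) * (1 - A h 1 1) - A h 0 1 * A h 1 0 = h ^+ 2 * num h.
  by rewrite /num; field; rewrite gt_eqF.
have -> : b h 0 0 + A h 0 1 * b h 1 0 - A h 1 1 * b h 0 0 = h * den h.
  by rewrite /den; field; rewrite gt_eqF.
(* Only [0 < h] is known here, so the inverses of [den h] and [alpha] stay opaque and the powers of
   [h] cancel through [hV] alone. *)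
rewrite !invfM.
have hV : h * h^-1 = 1 by rewrite divff// gt_eqF.
rewrite (_ : h ^+ 2 * num h * (h^-1 / den h) = h * (num h / den h)); last first.
  by rewrite -[h * (num h / den h)]mulr1 -[in RHS]hV; ring.
rewrite -[LHS]mulr1 -[X in _ * X]mulr1 -{1}hV -hV; ring.
Qed.

End small_step_limit.

Theorem theorem4p4 (R : realType) (d : measure_display) (T : measurableType d)
    (P : probability T R) (F : R -> set_system T) (W : R -> T -> R)
    (alpha x0 y0 : R) (A : R -> 'M[R]_2) (b : R -> 'cV[R]_2)
    (halpha : 0 < alpha)
    (hPF : complete_filtered_probability_space P F)
    (hW : brownian_motion P F W)
    (hb : forall h : R, 0 < h -> (b h 0 0) ^+ 2 + (b h 1 0) ^+ 2 != 0) :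
  (forall h : R, 0 < h ->
     condA1 (A h) -> condA3 (A h) -> condA4 (A h) (b h) ->
     ~ symplectic_method P W alpha h (A h) (b h) /\
     good_rate_function (fun y => (method_rate alpha h (A h) (b h) y)%:E) /\
     LDP P (mean_position W alpha h (A h) (b h) (vec2 x0 y0))
       (fun y => (method_rate alpha h (A h) (b h) y)%:E)) /\
  ((\forall h \near 0^'+,
      condA1 (A h) /\ condA3 (A h) /\ condA4 (A h) (b h)) ->
   condB A b ->
   forall y : R, y != 0 ->
     exists l : R,
       modified_rate alpha h (A h) (b h) y @[h --> 0^'+] --> l /\
       l <> exact_rate alpha y).

Proof.
have [_ hF _] := hPF; split.
  move=> h h0 A1 A3 A4; split; last exact: (mean_position_LDP P F).
  by apply: not_symplectic_method; have /andP[_ /lt_eqF ->] := A3.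
move=> _ hB y hy; exists (y ^+ 2 / (2 * alpha ^+ 2)); split.
  exact: modified_rate_cvg.
rewrite /exact_rate => eq_rate.
(* The two rates are 1/2 and 1/3 of this nonzero quantity. *)
have : y ^+ 2 / alpha ^+ 2 != 0.
  by rewrite mulf_neq0 ?invr_eq0 ?expf_neq0// gt_eqF.
move/eqP; apply; move: eq_rate; rewrite !invfM.
by lra.
Qed.
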